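(* Let $A_1B_1C_1$, $A_2B_2C_2$, $A_3B_3C_3$ be three triangles in a plane that are pairwise homological (with the vertex correspondence $A_i\leftrightarrow A_j$, $B_i\leftrightarrow B_j$, $C_i\leftrightarrow C_j$) and whose three homological centers coincide, i.e. there is a point $O$ that is the homological center of each pair of these triangles. Then the three homological axes (of the pairs $(1,2)$, $(1,3)$, $(2,3)$) are concurrent.
   Context: Work in the real plane completed with its points at infinity (the real projective plane); concurrent lines may meet at a point at infinity. Two (non-degenerate) triangles $ABC$ and $A'B'C'$, with vertex correspondence $A\leftrightarrow A'$, $B\leftrightarrow B'$, $C\leftrightarrow C'$, corresponding vertices distinct and corresponding side lines distinct, are called homological (perspective) if the lines $AA'$, $BB'$, $CC'$ pass through a common point, called the homological center. By Desargues' theorem the points $BC\cap B'C'$, $CA\cap C'A'$, $AB\cap A'B'$ are then collinear, and the line containing them is called the homological axis. *)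

(* Defs.v *)
(* [R : realType] is the field of real numbers, complete and archimedean. *)
From HB Require Import structures.
From mathcomp Require Import all_boot all_order all_algebra.
From mathcomp Require Import reals.

Set Implicit Arguments.
Unset Strict Implicit.
Unset Printing Implicit Defensive.

Import GRing.Theory.
Local Open Scope ring_scope.

(* The real projective plane, in homogeneous coordinates: its points and lines
   are the 1- and 2-dimensional subspaces of R^3, and incidence is inclusion.
   The ordinary point (x, y) is the span of (x, y, 1); the points at infinity
   are the subspaces [(x, y, 0)], all on the line at infinity z = 0. *)
Record point (R : realType) := Point {
  point_space :> {vspace 'rV[R]_3};
  point_dim : \dim point_space == 1%N }.

Record line (R : realType) := Line {
  line_space :> {vspace 'rV[R]_3};
  line_dim : \dim line_space == 2%N }.

(* So equality of points and of lines is equality of subspaces ([val_inj]). *)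
HB.instance Definition _ (R : realType) := [isSub for @point_space R].
HB.instance Definition _ (R : realType) := [isSub for @line_space R].

Definition collinear (R : realType) (P Q S : point R) : Prop :=
  exists l : line R, [/\ (P <= l)%VS, (Q <= l)%VS & (S <= l)%VS].

Definition concurrent (R : realType) (l m n : line R) : Prop :=
  exists P : point R, [/\ (P <= l)%VS, (P <= m)%VS & (P <= n)%VS].

(* A line only when [P <> Q], which is the case wherever it is used below. *)
Definition line_through (R : realType) (P Q : point R) : {vspace 'rV[R]_3} :=
  (P + Q)%VS.

Record triangle (R : realType) := Triangle {
  vA : point R;
  vB : point R;
  vC : point R;
  triangle_nondegenerate : ~ collinear vA vB vC }.

Definition sideBC (R : realType) (T : triangle R) := line_through (vB T) (vC T).
Definition sideCA (R : realType) (T : triangle R) := line_through (vC T) (vA T).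
Definition sideAB (R : realType) (T : triangle R) := line_through (vA T) (vB T).

Definition distinct_vertices (R : realType) (T T' : triangle R) : Prop :=
  [/\ vA T <> vA T', vB T <> vB T' & vC T <> vC T'].

Definition distinct_sides (R : realType) (T T' : triangle R) : Prop :=
  [/\ sideBC T <> sideBC T', sideCA T <> sideCA T' & sideAB T <> sideAB T'].

Definition homological_center (R : realType) (O : point R)
    (T T' : triangle R) : Prop :=
  [/\ (O <= line_through (vA T) (vA T'))%VS,
      (O <= line_through (vB T) (vB T'))%VS &
      (O <= line_through (vC T) (vC T'))%VS].

Definition homological (R : realType) (T T' : triangle R) : Prop :=
  [/\ distinct_vertices T T', distinct_sides T T' &
      exists O : point R, homological_center O T T'].

(* The intersection of two distinct lines of the projective plane is a point;
   [homological_axis_unique] below is Desargues' theorem: homological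
   triangles have exactly one axis. *)
Definition homological_axis (R : realType) (l : line R)
    (T T' : triangle R) : Prop :=
  [/\ (sideBC T :&: sideBC T' <= l)%VS,
      (sideCA T :&: sideCA T' <= l)%VS &
      (sideAB T :&: sideAB T' <= l)%VS].

Lemma pointE (R : realType) (P : point R) :
  exists2 a, (P : {vspace _}) = <[a]>%VS & a != 0.
Proof.
have nz : vpick P != 0.
  by rewrite vpick0 -dimv_eq0 (eqP (point_dim P)).
exists (vpick P) => //; apply/esym/eqP.
by rewrite eqEdim (eqP (point_dim P)) dim_vline nz -memvE memv_pick.
Qed.

Lemma line_containing (R : realType) (U : {vspace 'rV[R]_3}) :
  (\dim U <= 2)%N -> exists l : line R, (U <= l)%VS.
Proof.
elim: {U}(2 - \dim U)%N {-2}U (erefl (2 - \dim U)%N) => [|k IHk] U dU leU2.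
  have d2 : \dim U == 2%N by rewrite eqn_leq leU2 -subn_eq0 dU.
  by exists (Line d2).
have nz : vpick (U^C) != 0.
  rewrite vpick0 -dimv_eq0 dimv_compl dimvf /dim /= -lt0n subn_gt0.
  by rewrite mul1n ltnS.
have d1 : \dim (U + <[vpick (U^C)]>) = (\dim U).+1.
  rewrite dimv_disjoint_sum ?dim_vline ?nz ?addn1 //.
  apply/eqP; rewrite -subv0 -(capv_compl U) capvS // -memvE.
  exact: memv_pick.
have ltU2 : (\dim U < 2)%N by rewrite -subn_gt0 dU.
have [||l Ul] := IHk (U + <[vpick (U^C)]>)%VS; rewrite ?d1 //.
  by rewrite subnS dU.
by exists l; apply: subv_trans Ul; apply: addvSl.
Qed.

Lemma triangle_free (R : realType) (T : triangle R) (a b c : 'rV[R]_3) :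
    (vA T : {vspace _}) = <[a]>%VS -> (vB T : {vspace _}) = <[b]>%VS ->
    (vC T : {vspace _}) = <[c]>%VS ->
  forall x y z : R, x *: a + y *: b + z *: c = 0 -> [/\ x = 0, y = 0 & z = 0].
Proof.
move=> EA EB EC x y z xyz0.
have spanE : <<[:: a; b; c]>>%VS = (vA T + vB T + vC T)%VS.
  by rewrite EA EB EC !span_cons span_nil addv0 addvA.
have fr : free [:: a; b; c].
  rewrite /free spanE eqn_leq; apply/andP; split.
    by rewrite -spanE; apply: dim_span.
  rewrite leqNgt; apply/negP => /line_containing [l].
  rewrite !subv_add => /andP[/andP[Al Bl] Cl].
  by apply: (triangle_nondegenerate (t := T)); exists l.
have /freeP/(_ (fun i : 'I_3 => [:: x; y; z]`_i)) := fr.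
rewrite !big_ord_recl big_ord0 /= addr0 addrA => /(_ xyz0) k0.
by split; [exact: (k0 ord0) | exact: (k0 (lift ord0 ord0)) |
  exact: (k0 (lift ord0 (lift ord0 ord0)))].
Qed.

Lemma dim_line2 (R : realType) (a b : 'rV[R]_3) :
    (forall x y : R, x *: a + y *: b = 0 -> x = 0 /\ y = 0) ->
  \dim (<[a]> + <[b]>) = 2%N.
Proof.
move=> ind; have fr : free [:: a; b].
  apply/(@freeP _ _ 2 [tuple a; b]) => k.
  rewrite !big_ord_recl big_ord0 /= addr0 => /ind[k0 k1] i.
  case: i => [[|[|i]] // lti]; [rewrite -[RHS]k0 | rewrite -[RHS]k1];
  by congr (k _); apply: val_inj.
by move: fr; rewrite /free span_cons span_seq1 => /eqP.
Qed.

Lemma meet_lines (R : realType) (U V : {vspace 'rV[R]_3}) (w : 'rV[R]_3) :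
    \dim U = 2%N -> \dim V = 2%N -> U <> V -> w \in U -> w \in V -> w != 0 ->
  (U :&: V)%VS = <[w]>%VS.
Proof.
move=> dU dV UV wU wV w0; apply/esym/eqP.
rewrite eqEdim -memvE memv_cap wU wV dim_vline w0 /= leqNgt.
apply/negP => lt1; apply: UV.
have /eqP <- : (U :&: V == U)%VS by rewrite eqEdim capvSl dU.
by apply/eqP; rewrite eqEdim capvSr dV.
Qed.

(* With O = <o>, the scaled representatives satisfy
   o = x a + x' a' = y b + y' b' = z c + z' c', so the three intersections are
   spanned by y b - z c, z c - x a and x a - y b, whose sum is 0. *)
Lemma homological_axis_unique (R : realType) (T T' : triangle R) :
  homological T T' -> exists! l : line R, homological_axis l T T'.
Proof.
case=> -[nA nB nC] [nBC nCA nAB] [O [OA OB OC]].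
have [a EA a0] := pointE (vA T); have [b EB b0] := pointE (vB T).
have [c EC c0] := pointE (vC T); have [a' EA' a'0] := pointE (vA T').
have [b' EB' b'0] := pointE (vB T'); have [c' EC' c'0] := pointE (vC T').
have [o EO o0] := pointE O.
have fr := triangle_free EA EB EC; have fr' := triangle_free EA' EB' EC'.
have rep (P Q : point R) p q : (P : {vspace _}) = <[p]>%VS ->
    (Q : {vspace _}) = <[q]>%VS -> (O <= line_through P Q)%VS ->
    exists x y : R, o = x *: p + y *: q.
  rewrite /line_through EO -memvE => -> ->.
  by case/memv_addP=> _ /vlineP[x ->] [_ /vlineP[y ->] ->]; exists x, y.
have [x [x' ox]] := rep _ _ _ _ EA EA' OA.
have [y [y' oy]] := rep _ _ _ _ EB EB' OB.
have [z [z' oz]] := rep _ _ _ _ EC EC' OC.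
have nz p p' q q' (r r' t t' : R) : o = r *: p + r' *: p' ->
    o = t *: q + t' *: q' ->
    (forall u v : R, u *: p + v *: q = 0 -> u = 0 /\ v = 0) ->
    (forall u v : R, u *: p' + v *: q' = 0 -> u = 0 /\ v = 0) ->
    r *: p - t *: q != 0.
  move=> e1 e2 f f'; apply: contra o0; rewrite -scaleNr => /eqP/f[r0 /eqP].
  rewrite oppr_eq0 => /eqP t0.
  move: e1 e2; rewrite r0 t0 !scale0r !add0r => e1 e2.
  have [r'0 _] : r' = 0 /\ - t' = 0.
    by apply: f'; rewrite scaleNr -e1 -e2 subrr.
  by rewrite e1 r'0 scale0r.
have meet p p' q q' (r r' t t' : R) : o = r *: p + r' *: p' ->
    o = t *: q + t' *: q' ->
    (forall u v : R, u *: p + v *: q = 0 -> u = 0 /\ v = 0) ->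
    (forall u v : R, u *: p' + v *: q' = 0 -> u = 0 /\ v = 0) ->
    (<[p]> + <[q]>)%VS <> (<[p']> + <[q']>)%VS ->
    ((<[p]> + <[q]>) :&: (<[p']> + <[q']>))%VS = <[r *: p - t *: q]>%VS.
  move=> e1 e2 f f' neq; apply: meet_lines; rewrite ?dim_line2 //.
  - by rewrite -scaleNr memv_add ?memvZ ?memv_line.
  - have -> : r *: p - t *: q = (- r') *: p' + t' *: q'.
      apply/eqP; rewrite -subr_eq0 scaleNr opprD opprK addrACA -e1.
      by rewrite -opprD -e2 subrr.
    by rewrite memv_add ?memvZ ?memv_line.
  - exact: nz e1 e2 f f'.
have fAB u v : u *: a + v *: b = 0 -> u = 0 /\ v = 0.
  by move=> e; have [] := fr u v 0; rewrite ?scale0r ?addr0.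
have fBC u v : u *: b + v *: c = 0 -> u = 0 /\ v = 0.
  by move=> e; have [] := fr 0 u v; rewrite ?scale0r ?add0r.
have fCA u v : u *: c + v *: a = 0 -> u = 0 /\ v = 0.
  by move=> e; have [] := fr v 0 u; rewrite ?scale0r ?addr0 1?addrC.
have fAB' u v : u *: a' + v *: b' = 0 -> u = 0 /\ v = 0.
  by move=> e; have [] := fr' u v 0; rewrite ?scale0r ?addr0.
have fBC' u v : u *: b' + v *: c' = 0 -> u = 0 /\ v = 0.
  by move=> e; have [] := fr' 0 u v; rewrite ?scale0r ?add0r.
have fCA' u v : u *: c' + v *: a' = 0 -> u = 0 /\ v = 0.
  by move=> e; have [] := fr' v 0 u; rewrite ?scale0r ?addr0 1?addrC.
move: nBC nCA nAB; rewrite /homological_axis /sideBC /sideCA /sideAB.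
rewrite /line_through EA EB EC EA' EB' EC' => nBC nCA nAB.
rewrite (meet _ _ _ _ _ _ _ _ oy oz) // (meet _ _ _ _ _ _ _ _ oz ox) //.
rewrite (meet _ _ _ _ _ _ _ _ ox oy) //.
have wc0 := nz _ _ _ _ _ _ _ _ ox oy fAB fAB'.
have wa0 := nz _ _ _ _ _ _ _ _ oy oz fBC fBC'.
have wb0 := nz _ _ _ _ _ _ _ _ oz ox fCA fCA'.
set wa := y *: b - z *: c in wa0 *; set wb := z *: c - x *: a in wb0 *.
set wc := x *: a - y *: b in wc0 *.
have wcE : wc = - wa - wb.
  by rewrite /wa /wb /wc !opprB [RHS]addrC addrA subrK.
have d2 : \dim (<[wa]> + <[wb]>) == 2%N.
  apply/eqP/dim_line2 => s t st0.
  have [] := fr (- (t * x)) (s * y) ((t - s) * z).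
    rewrite -[RHS]st0 /wa /wb !scalerBr !scalerA mulrBl scalerBl scaleNr.
    by rewrite addrACA addrC; congr (_ + _); apply: addrC.
  move=> /eqP; rewrite oppr_eq0 mulf_eq0 => /orP tx /eqP.
  rewrite mulf_eq0 => /orP sy /eqP; rewrite mulf_eq0 subr_eq0 => /orP tsz.
  have c1 : y = 0 -> z = 0 -> False.
    by move=> y0 z0; move: wa0; rewrite /wa y0 z0 !scale0r subrr eqxx.
  have c2 : z = 0 -> x = 0 -> False.
    by move=> y0 z0; move: wb0; rewrite /wb y0 z0 !scale0r subrr eqxx.
  have c3 : x = 0 -> y = 0 -> False.
    by move=> y0 z0; move: wc0; rewrite /wc y0 z0 !scale0r subrr eqxx.
  case: tx => /eqP t0; case: sy => /eqP s0; case: tsz => /eqP u0 //.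
  - by rewrite -u0 t0.
  - by case: (c1 s0 u0).
  - by rewrite u0 s0.
  - by case: (c2 u0 t0).
  - by case: (c3 t0 s0).
  - by case: (c3 t0 s0).
exists (Line d2); split=> [|l [la lb _]].
  split; rewrite /= ?addvSl ?addvSr // -memvE wcE.
  by rewrite memv_add // memvN memv_line.
apply/val_inj/eqP; rewrite eqEdim subv_add la lb.
by rewrite (eqP d2) (eqP (line_dim l)).
Qed.

(* Main.v *)
Require Import Defs.
From mathcomp Require Import all_boot all_order all_algebra.
From mathcomp Require Import reals.

(* Let o, a_i, b_i, c_i represent O and the vertices of T_i. On the line
   through O, A_1, A_2, A_3 there are weights p_i, not all 0, such that the
   vectors p_i a_i agree modulo o; similarly q_i for the b_i and r_i for the
   c_i. Two linear equations in three unknowns (t, u, v) make the vectors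
   t p_i a_i + u q_i b_i + v r_i c_i equal, not only equal modulo o, and their
   common value spans a point lying on the three axes. *)

Set Implicit Arguments.
Unset Strict Implicit.
Unset Printing Implicit Defensive.

Import GRing.Theory.
Local Open Scope ring_scope.

Lemma distinct_points_free (R : realType) (P Q : point R) (a b : 'rV[R]_3) :
    (P : {vspace _}) = <[a]>%VS -> (Q : {vspace _}) = <[b]>%VS -> P <> Q ->
  forall x y : R, x *: a + y *: b = 0 -> x = 0 /\ y = 0.
Proof.
move=> EP EQ PQ x y xy0.
have x0 : x = 0.
  apply/eqP/negPn/negP => x0; apply: PQ; apply/val_inj/eqP => /=.
  rewrite eqEdim (eqP (point_dim P)) (eqP (point_dim Q)) andbT EP EQ -memvE.
  apply/vlineP; exists (- (x^-1 * y)).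
  apply: (scalerI x0); rewrite scalerA mulrN mulVKf // scaleNr.
  by apply/eqP; rewrite -addr_eq0 xy0.
split=> //; move: xy0; rewrite x0 scale0r add0r => /eqP.
rewrite scaler_eq0 => /orP[/eqP //|b0].
by have := point_dim Q; rewrite EQ dim_vline b0.
Qed.

Lemma mem_line_through (R : realType) (O P Q : point R) (o a b : 'rV[R]_3) :
    (O : {vspace _}) = <[o]>%VS -> (P : {vspace _}) = <[a]>%VS ->
    (Q : {vspace _}) = <[b]>%VS -> (O <= line_through P Q)%VS ->
  exists x y : R, o = x *: a + y *: b.
Proof.
rewrite /line_through => -> -> ->; rewrite -memvE.
by case/memv_addP=> _ /vlineP[x ->] [_ /vlineP[y ->] ->]; exists x, y.
Qed.

(** Equating the two expressions of [o] gives [x *: a - y *: b = y' *: b' - x' *: a'], whose two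
    sides lie on the two lines. *)
Lemma mem_side_cap (R : realType) (P Q P' Q' : point R)
    (a b a' b' o : 'rV[R]_3) (x x' y y' : R) :
    (P : {vspace _}) = <[a]>%VS -> (Q : {vspace _}) = <[b]>%VS ->
    (P' : {vspace _}) = <[a']>%VS -> (Q' : {vspace _}) = <[b']>%VS ->
    o = x *: a + x' *: a' -> o = y *: b + y' *: b' ->
  x *: a - y *: b \in (line_through P Q :&: line_through P' Q')%VS.
Proof.
rewrite /line_through => -> -> -> -> ox oy; rewrite memv_cap.
have e : x *: a - y *: b = (- x') *: a' + y' *: b'.
  apply/eqP; rewrite -subr_eq0 scaleNr opprD opprK addrACA -ox.
  by rewrite -opprD -oy subrr.
by rewrite {2}e -scaleNr !memv_add ?memvZ ?memv_line.
Qed.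

(** The condition [s + t + u = 0] turns the sum of the weighted vertices into a combination of
    differences [x *: a - y *: b] and [z *: c - x *: a], where [o] has coefficients [x], [y], [z] at
    [a], [b], [c]. By [mem_side_cap] both differences lie on the axis. *)
Lemma mem_homological_axis (R : realType) (T T' : triangle R) (O : point R)
    (l : line R) (o a b c a' b' c' : 'rV[R]_3) (p q r p' q' r' s t u : R) :
    distinct_vertices T T' -> homological_center O T T' ->
    homological_axis l T T' -> (O : {vspace _}) = <[o]>%VS ->
    (vA T : {vspace _}) = <[a]>%VS -> (vB T : {vspace _}) = <[b]>%VS ->
    (vC T : {vspace _}) = <[c]>%VS -> (vA T' : {vspace _}) = <[a']>%VS ->
    (vB T' : {vspace _}) = <[b']>%VS -> (vC T' : {vspace _}) = <[c']>%VS ->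
    p *: a - p' *: a' = s *: o -> q *: b - q' *: b' = t *: o ->
    r *: c - r' *: c' = u *: o -> s + t + u = 0 ->
  p *: a + q *: b + r *: c \in (l : {vspace _}).
Proof.
move=> [nA nB nC] [OA OB OC] [_ /subvP lCA /subvP lAB] EO EA EB EC EA' EB' EC'.
have [x [x' ox]] := mem_line_through EO EA EA' OA.
have [y [y' oy]] := mem_line_through EO EB EB' OB.
have [z [z' oz]] := mem_line_through EO EC EC' OC.
(* Distinct vertices have independent representatives, so the coefficients of [d] can be
   compared. *)
have weight (P P' : point R) (d d' : 'rV[R]_3) (k k' m n n' : R) :
    (P : {vspace _}) = <[d]>%VS -> (P' : {vspace _}) = <[d']>%VS ->
    P <> P' -> o = n *: d + n' *: d' ->
    k *: d - k' *: d' = m *: o -> k = m * n.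
  move=> EP EP' neq -> e.
  have [|/eqP+ _] := distinct_points_free EP EP' neq
    (x := k - m * n) (y := - k' - m * n').
    move/eqP: e; rewrite -subr_eq0 scalerDr opprD addrACA !scalerA => /eqP e.
    by rewrite !scalerBl scaleNr.
  by rewrite subr_eq0 => /eqP.
move=> /(weight _ _ _ _ _ _ _ _ _ EA EA' nA ox) ->.
move=> /(weight _ _ _ _ _ _ _ _ _ EB EB' nB oy) ->.
move=> /(weight _ _ _ _ _ _ _ _ _ EC EC' nC oz) -> /eqP.
rewrite addrAC addr_eq0 => /eqP et.
have wAB := lAB _ (mem_side_cap EA EB EA' EB' ox oy).
have wCA := lCA _ (mem_side_cap EC EA EC' EA' oz ox).
have -> : (s * x) *: a + (t * y) *: b + (u * z) *: c =
    (- t) *: (x *: a - y *: b) + u *: (z *: c - x *: a).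
  have -> : s = - t - u by rewrite -et addrK.
  rewrite !scalerBr !scalerA mulrBl scalerBl !mulNr !scaleNr opprK.
  by rewrite -!addrA; congr (_ + _); rewrite addrC -addrA addrC.
by rewrite memvD // memvZ.
Qed.

Lemma agreeing_weights (R : realType) (O P1 P2 P3 : point R)
    (o a1 a2 a3 : 'rV[R]_3) :
    (O : {vspace _}) = <[o]>%VS -> o != 0 ->
    (P1 : {vspace _}) = <[a1]>%VS -> (P2 : {vspace _}) = <[a2]>%VS ->
    (P3 : {vspace _}) = <[a3]>%VS -> P2 <> P3 ->
    (O <= line_through P1 P2)%VS -> (O <= line_through P1 P3)%VS ->
  exists p1 p2 p3 s t : R,
    [/\ p1 *: a1 - p2 *: a2 = s *: o, p1 *: a1 - p3 *: a3 = t *: o &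
        ~ [/\ p1 = 0, p2 = 0 & p3 = 0]].
Proof.
move=> EO o0 E1 E2 E3 n23 O12 O13.
have [x [x' ox]] := mem_line_through EO E1 E2 O12.
have [y [y' oy]] := mem_line_through EO E1 E3 O13.
(* Multiplying [ox] by [y] and [oy] by [x] gives [a1] the same weight [y * x] in both relations. *)
have e2 : (y * x) *: a1 - (- (y * x')) *: a2 = y *: o.
  by rewrite scaleNr opprK ox scalerDr !scalerA.
have e3 : (y * x) *: a1 - (- (x * y')) *: a3 = x *: o.
  by rewrite scaleNr opprK oy scalerDr !scalerA (mulrC y).
exists (y * x), (- (y * x')), (- (x * y')), y, x; split=> // -[z1 z2 z3].
(* If all weights vanish, then [x = y = 0], so [o] is a multiple of both [a2] and [a3]; as
   [P2 <> P3], this forces [o = 0]. *)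
move: e2 e3; rewrite z1 z2 z3 !scale0r subrr.
move=> /esym/eqP; rewrite scaler_eq0 (negPf o0) orbF => /eqP y0.
move=> /esym/eqP; rewrite scaler_eq0 (negPf o0) orbF => /eqP x0.
move: ox oy; rewrite x0 y0 !scale0r !add0r => ox oy.
have [|x'0 _] := distinct_points_free E2 E3 n23 (x := x') (y := - y').
  by rewrite scaleNr -ox -oy subrr.
by move: o0; rewrite ox x'0 scale0r eqxx.
Qed.

Lemma two_equations_three_unknowns (F : fieldType) (a b c a' b' c' : F) :
  exists t u v : F, [/\ t * a + u * b + v * c = 0,
    t * a' + u * b' + v * c' = 0 & ~ [/\ t = 0, u = 0 & v = 0]].
Proof.
(* The equations are the columns of [M], since [kermx] is the left kernel; it is nonzero because the
   rank is at most 2. *)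
pose M : 'M[F]_(3, 2) := \matrix_(i, j)
  (nth [::] [:: [:: a; b; c]; [:: a'; b'; c']] j)`_i.
have : kermx M != 0.
  by rewrite kermx_eq0 /row_free neq_ltn (leq_ltn_trans (rank_leq_col M)).
case/rowV0Pn=> w /sub_kermxP wM w0.
exists (w 0 0), (w 0 1), (w 0 2%:R).
have ord3 (i : 'I_3) : [\/ i = 0, i = 1 | i = 2%:R].
  case: i => [[|[|[|]]]] // lti;
    [apply: Or31 | apply: Or32 | apply: Or33]; exact: val_inj.
have wE j : w 0 0 * M 0 j + w 0 1 * M 1 j + w 0 2%:R * M 2%:R j = 0.
  have /matrixP/(_ 0 j) := wM; rewrite mxE [RHS]mxE !big_ord_recl big_ord0 addr0 addrA.
  by move=> <-; do 2?congr (_ + _); congr (w _ _ * M _ _); apply: val_inj.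
split; first by have := wE 0; rewrite !mxE.
- by have := wE 1; rewrite !mxE.
- case=> t0 u0 v0; case/eqP: w0; apply/rowP => i; rewrite mxE.
  by case: (ord3 i) => ->.
Qed.

Theorem theorem1 (R : realType) (T1 T2 T3 : triangle R)
    (h12 : homological T1 T2) (h13 : homological T1 T3)
    (h23 : homological T2 T3)
    (O : point R)
    (c12 : homological_center O T1 T2) (c13 : homological_center O T1 T3)
    (c23 : homological_center O T2 T3)
    (l12 l13 l23 : line R)
    (a12 : homological_axis l12 T1 T2) (a13 : homological_axis l13 T1 T3)
    (a23 : homological_axis l23 T2 T3) :
  concurrent l12 l13 l23.
Proof.
have [n12 _ _] := h12; have [n13 _ _] := h13; have [n23 _ _] := h23.
have [o EO o0] := pointE O.
have [a1 EA1 _] := pointE (vA T1); have [b1 EB1 _] := pointE (vB T1).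
have [c1 EC1 _] := pointE (vC T1); have [a2 EA2 _] := pointE (vA T2).
have [b2 EB2 _] := pointE (vB T2); have [c2 EC2 _] := pointE (vC T2).
have [a3 EA3 _] := pointE (vA T3); have [b3 EB3 _] := pointE (vB T3).
have [c3 EC3 _] := pointE (vC T3).
have [nA nB nC] := n23; have [A12 B12 C12] := c12; have [A13 B13 C13] := c13.
have [p1 [p2 [p3 [sA [tA [eA2 eA3 pn0]]]]]] :=
  agreeing_weights EO o0 EA1 EA2 EA3 nA A12 A13.
have [q1 [q2 [q3 [sB [tB [eB2 eB3 qn0]]]]]] :=
  agreeing_weights EO o0 EB1 EB2 EB3 nB B12 B13.
have [r1 [r2 [r3 [sC [tC [eC2 eC3 rn0]]]]]] :=
  agreeing_weights EO o0 EC1 EC2 EC3 nC C12 C13.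
(* [es] makes the weighted sums over [T1] and [T2] equal, and [et] those over [T1] and [T3]: the
   multiples of [o] cancel. *)
have [t [u [v [es et tuv]]]] :=
  two_equations_three_unknowns sA sB sC tA tB tC.
have scaled k p p' m (d d' : 'rV[R]_3) : p *: d - p' *: d' = m *: o ->
    (k * p) *: d - (k * p') *: d' = (k * m) *: o.
  by move=> e; rewrite -!scalerA -scalerBr e.
have {eA2}fA2 := scaled t _ _ _ _ _ eA2.
have {eA3}fA3 := scaled t _ _ _ _ _ eA3.
have {eB2}fB2 := scaled u _ _ _ _ _ eB2.
have {eB3}fB3 := scaled u _ _ _ _ _ eB3.
have {eC2}fC2 := scaled v _ _ _ _ _ eC2.
have {eC3}fC3 := scaled v _ _ _ _ _ eC3.
pose w := (t * p1) *: a1 + (u * q1) *: b1 + (v * r1) *: c1.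
have same (d e f d' e' f' : 'rV[R]_3) (i j k : R) : d - d' = i *: o ->
    e - e' = j *: o -> f - f' = k *: o -> i + j + k = 0 ->
    d + e + f = d' + e' + f'.
  move=> ed ee ef ijk; apply/eqP; rewrite -subr_eq0 !opprD.
  by rewrite addrACA (addrACA d) ed ee ef -!scalerDl ijk scale0r.
have w2 := same _ _ _ _ _ _ _ _ _ fA2 fB2 fC2 es.
have w3 := same _ _ _ _ _ _ _ _ _ fA3 fB3 fC3 et.
(* If [w = 0], its expressions over the three triangles force every scaled weight to vanish. Each of
   [t], [u], [v] multiplies a triple of weights that are not all 0, so all three would be 0, against
   [tuv]. *)
have w0 : w != 0.
  apply/eqP => w0.
  have [P1 Q1 R1] := triangle_free EA1 EB1 EC1 w0.
  have [P2 Q2 R2] := triangle_free EA2 EB2 EC2 (etrans (esym w2) w0).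
  have [P3 Q3 R3] := triangle_free EA3 EB3 EC3 (etrans (esym w3) w0).
  have cancel (k i1 i2 i3 : R) : k * i1 = 0 -> k * i2 = 0 -> k * i3 = 0 ->
      ~ [/\ i1 = 0, i2 = 0 & i3 = 0] -> k = 0.
    move=> k1 k2 k3 n; apply/eqP/negPn/negP => k0; apply: n.
    by split; apply: (mulfI k0); rewrite mulr0.
  by apply: tuv; split; [apply: cancel pn0 | apply: cancel qn0 |
    apply: cancel rn0].
have dw : \dim <[w]> == 1%N by rewrite dim_vline w0.
(* The relations for the pair (2,3) are differences of those for (1,3) and (1,2); their multiples of
   [o] sum to 0 by subtracting [es] from [et]. *)
have cocycle (d1 d2 d3 : 'rV[R]_3) (i j : R) : d1 - d2 = i *: o ->
    d1 - d3 = j *: o -> d2 - d3 = (j - i) *: o.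
  by move=> e2 e3; rewrite scalerBl -e2 -e3 opprB [RHS]addrC addrA subrK.
exists (Point dw); split; rewrite /= -memvE.
- exact: (mem_homological_axis n12 c12 a12 EO EA1 EB1 EC1 EA2 EB2 EC2
    fA2 fB2 fC2 es).
- exact: (mem_homological_axis n13 c13 a13 EO EA1 EB1 EC1 EA3 EB3 EC3
    fA3 fB3 fC3 et).
- rewrite /w w2.
  apply: (mem_homological_axis n23 c23 a23 EO EA2 EB2 EC2 EA3 EB3 EC3
    (cocycle _ _ _ _ _ fA2 fA3) (cocycle _ _ _ _ _ fB2 fB3)
    (cocycle _ _ _ _ _ fC2 fC3)).
  by rewrite [X in X + _]addrACA -opprD addrACA -opprD es et subrr.
Qed.
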